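(* Let $S$ be a quasi completely regular semiring. Then $\mathscr{Y}^{*}\in[\epsilon,\nu]$, where $\epsilon$ is the equality congruence and $\nu$ is the least b-lattice of skew-rings congruence on $S$.
   Context: A semiring $(S,+,\cdot)$ consists of two semigroups $(S,+)$, $(S,\cdot)$ (addition not assumed commutative; no zero or identity assumed) with two-sided distributivity of $\cdot$ over $+$. For a positive integer $n$, $na$ is the $n$-fold sum of $a$. An element $a$ is completely regular if there is $x\in S$ with $a=a+x+a$, $a+x=x+a$ and $a(a+x)=a+x$. $S$ is quasi completely regular if for every $a\in S$ some $na$ ($n\ge1$) is completely regular. $V^+(a)=\{x\in S: a+x+a=a,\ x+a+x=x\}$ is the set of additive inverses of $a$. A skew-ring is a semiring whose additive reduct is a (not necessarily abelian) group. A quasi skew-ring is a semiring $T$ with a subskew-ring $R$ such that every $a\in T$ has some positive multiple $na\in R$. It is known that a semiring $S$ is quasi completely regular iff it is an idempotent semiring $I$ of quasi skew-rings $T_i$ (i.e. there is a semiring congruence with quotient $I$ an idempotent semiring, both reducts being bands, whose classes are the quasi skew-rings $T_i$). For $x\in S$, $0_x$ denotes the unique additive idempotent in the $T_i$ containing $x$ (equivalently, the identity of the maximal additive subgroup containing some positive multiple $nx$). The relation $\mathscr{Y}$ on $S$ is defined by: $a\,\mathscr{Y}\,b$ iff $V^{+}(a+0_a)=V^{+}(b+0_b)$; $\mathscr{Y}^*$ is the semiring congruence on $S$ generated by $\mathscr{Y}$. A b-lattice is a semiring $Y$ such that $(Y,\cdot)$ is a band and $(Y,+)$ is a semilattice.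 A b-lattice of skew-rings is a semiring admitting a semiring congruence whose quotient is a b-lattice and whose classes are skew-rings. A b-lattice of skew-rings congruence on $S$ is a semiring congruence $\xi$ such that $S/\xi$ is a b-lattice of skew-rings; $\nu$ is the least such congruence. $[\epsilon,\nu]$ is the interval in the lattice of semiring congruences on $S$ ordered by inclusion, i.e. the set of congruences $\xi$ with $\epsilon\subseteq\xi\subseteq\nu$. *)

(* Defs.v *)
From Stdlib Require Import PArith Relations.
From Stdlib Require Import FunctionalExtensionality PropExtensionality.
From Stdlib Require Import ProofIrrelevance ClassicalEpsilon.

Set Implicit Arguments.
Unset Strict Implicit.

Record semiring : Type := Semiring {
  carrier :> Type;
  add : carrier -> carrier -> carrier;
  mul : carrier -> carrier -> carrier;
  addA : forall x y z, add x (add y z) = add (add x y) z;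
  mulA : forall x y z, mul x (mul y z) = mul (mul x y) z;
  mulDl : forall x y z, mul (add x y) z = add (mul x z) (mul y z);
  mulDr : forall x y z, mul x (add y z) = add (mul x y) (mul x z)
}.

Arguments add {s} _ _.
Arguments mul {s} _ _.

Declare Scope semiring_scope.
Delimit Scope semiring_scope with SR.
Notation "x + y" := (add x y) : semiring_scope.
Notation "x * y" := (mul x y) : semiring_scope.
Local Open Scope semiring_scope.

Definition nfold (S : semiring) (n : positive) (a : S) : S :=
  Pos.iter_op add n a.

Definition completely_regular (S : semiring) (a : S) : Prop :=
  exists x : S, a = a + x + a /\ a + x = x + a /\ a * (a + x) = a + x.

Definition quasi_completely_regular (S : semiring) : Prop :=
  forall a : S, exists n : positive, completely_regular (nfold n a).

Definition additive_inverses (S : semiring) (a : S) : S -> Prop :=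
  fun x => a + x + a = a /\ x + a + x = x.

(** * Congruences and quotients *)

Record congruence (S : semiring) : Type := Congruence {
  cong_rel :> S -> S -> Prop;
  cong_equiv : equivalence S cong_rel;
  cong_add : forall x x' y y',
    cong_rel x x' -> cong_rel y y' -> cong_rel (x + y) (x' + y');
  cong_mul : forall x x' y y',
    cong_rel x x' -> cong_rel y y' -> cong_rel (x * y) (x' * y')
}.

Section Quotient.
Variables (S : semiring) (xi : congruence S).

Lemma cong_refl x : xi x x.
Proof. exact (equiv_refl _ _ (cong_equiv xi) x). Qed.

Lemma cong_sym x y : xi x y -> xi y x.
Proof. exact (equiv_sym _ _ (cong_equiv xi) x y). Qed.

Lemma cong_trans x y z : xi x y -> xi y z -> xi x z.
Proof. exact (equiv_trans _ _ (cong_equiv xi) x y z). Qed.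

Lemma cong_class_ext x y : xi x y -> xi x = xi y.
Proof.
intros H; apply functional_extensionality; intros z.
apply propositional_extensionality; split; intros H'.
- exact (cong_trans (cong_sym H) H').
- exact (cong_trans H H').
Qed.

Definition quotient_carrier : Type := {A : S -> Prop | exists x, A = xi x}.

Definition class_of (x : S) : quotient_carrier :=
  exist _ (xi x) (ex_intro _ x eq_refl).

Lemma class_of_surj (A : quotient_carrier) : exists x, A = class_of x.
Proof.
destruct A as [A [x ->]]; exists x; unfold class_of.
now f_equal; apply proof_irrelevance.
Qed.

Lemma class_of_eq x y : class_of x = class_of y <-> xi x y.
Proof.
split; intros H.
- apply (f_equal (@proj1_sig _ _)) in H; simpl in H.
  rewrite H; apply cong_refl.
- unfold class_of; revert H; intros H.
  apply eq_sig_hprop; [intros; apply proof_irrelevance | exact (cong_class_ext H)].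
Qed.

Section Lift.
Variables (op : S -> S -> S)
  (op_cong : forall x x' y y', xi x x' -> xi y y' -> xi (op x y) (op x' y')).

Definition lift_set (A B : S -> Prop) : S -> Prop :=
  fun z => exists x y, A x /\ B y /\ xi (op x y) z.

Lemma lift_setE x y : lift_set (xi x) (xi y) = xi (op x y).
Proof.
apply functional_extensionality; intros z.
apply propositional_extensionality; split.
- intros (x' & y' & Hx & Hy & Hz).
  exact (cong_trans (op_cong Hx Hy) Hz).
- intros Hz; exists x, y; repeat split; auto using cong_refl.
Qed.

Lemma lift_subproof (A B : quotient_carrier) :
  exists z, lift_set (proj1_sig A) (proj1_sig B) = xi z.
Proof.
destruct A as [A [x ->]], B as [B [y ->]]; exists (op x y); apply lift_setE.
Qed.

Definition lift (A B : quotient_carrier) : quotient_carrier :=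
  exist _ (lift_set (proj1_sig A) (proj1_sig B)) (lift_subproof A B).

Lemma liftE x y : lift (class_of x) (class_of y) = class_of (op x y).
Proof.
apply eq_sig_hprop; [intros; apply proof_irrelevance | apply lift_setE].
Qed.
End Lift.

Local Notation qadd := (lift (op := add) (cong_add (c := xi))).
Local Notation qmul := (lift (op := mul) (cong_mul (c := xi))).

Lemma qaddA A B C : qadd A (qadd B C) = qadd (qadd A B) C.
Proof.
destruct (class_of_surj A) as [x ->], (class_of_surj B) as [y ->],
  (class_of_surj C) as [z ->].
now rewrite !liftE, addA.
Qed.

Lemma qmulA A B C : qmul A (qmul B C) = qmul (qmul A B) C.
Proof.
destruct (class_of_surj A) as [x ->], (class_of_surj B) as [y ->],
  (class_of_surj C) as [z ->].
now rewrite !liftE, mulA.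
Qed.

Lemma qmulDl A B C : qmul (qadd A B) C = qadd (qmul A C) (qmul B C).
Proof.
destruct (class_of_surj A) as [x ->], (class_of_surj B) as [y ->],
  (class_of_surj C) as [z ->].
now rewrite !liftE, mulDl.
Qed.

Lemma qmulDr A B C : qmul A (qadd B C) = qadd (qmul A B) (qmul A C).
Proof.
destruct (class_of_surj A) as [x ->], (class_of_surj B) as [y ->],
  (class_of_surj C) as [z ->].
now rewrite !liftE, mulDr.
Qed.

Definition quotient : semiring := Semiring qaddA qmulA qmulDl qmulDr.

Lemma quotient_addE x y :
  ((class_of x : quotient) + (class_of y : quotient)) = class_of (x + y).
Proof. exact (liftE _ x y). Qed.

Lemma quotient_mulE x y :
  ((class_of x : quotient) * (class_of y : quotient)) = class_of (x * y).
Proof. exact (liftE _ x y). Qed.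
End Quotient.

Definition eq_congruence (S : semiring) : congruence S.
Proof.
refine (@Congruence S (@eq S) _ _ _).
- split; [intros x | intros x y z | intros x y]; congruence.
- intros; congruence.
- intros; congruence.
Defined.

Definition generated_congruence (S : semiring) (R : relation S) : congruence S.
Proof.
refine (@Congruence S
  (fun x y => forall xi : congruence S, inclusion S R xi -> xi x y) _ _ _).
- split.
  + intros x xi _; apply cong_refl.
  + intros x y z Hxy Hyz xi Hxi.
    exact (cong_trans (Hxy xi Hxi) (Hyz xi Hxi)).
  + intros x y Hxy xi Hxi; exact (cong_sym (Hxy xi Hxi)).
- intros x x' y y' Hx Hy xi Hxi; exact (cong_add (Hx xi Hxi) (Hy xi Hxi)).
- intros x x' y y' Hx Hy xi Hxi; exact (cong_mul (Hx xi Hxi) (Hy xi Hxi)).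
Defined.

Definition is_least_congruence (S : semiring) (P : congruence S -> Prop)
    (nu : congruence S) : Prop :=
  P nu /\ forall xi : congruence S, P xi -> inclusion S nu xi.

Definition congruence_interval (S : semiring) (lo hi : congruence S) :
    congruence S -> Prop :=
  fun xi => inclusion S lo xi /\ inclusion S xi hi.

(** * Skew-rings, quasi skew-rings, b-lattices of skew-rings *)

(* [G] is a subgroup of the additive semigroup of [S], with identity [e]. *)
Definition additive_subgroup (S : semiring) (G : S -> Prop) (e : S) : Prop :=
  G e /\
  (forall x y, G x -> G y -> G (x + y)) /\
  (forall x, G x -> e + x = x /\ x + e = x) /\
  (forall x, G x -> exists y, G y /\ x + y = e /\ y + x = e).

Definition maximal_additive_subgroup (S : semiring) (G : S -> Prop) (e : S) :
    Prop :=
  additive_subgroup G e /\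
  forall (H : S -> Prop) (f : S), additive_subgroup H f ->
    (forall x, G x -> H x) -> forall x, H x -> G x.

Definition subsemiring (S : semiring) (A : S -> Prop) : Prop :=
  forall x y, A x -> A y -> A (x + y) /\ A (x * y).

Definition subskew_ring (S : semiring) (R : S -> Prop) : Prop :=
  subsemiring R /\ exists e, additive_subgroup R e.

Definition quasi_subskew_ring (S : semiring) (T : S -> Prop) : Prop :=
  subsemiring T /\
  exists R : S -> Prop, (forall x, R x -> T x) /\ subskew_ring R /\
    forall a, T a -> exists n : positive, R (nfold n a).

Definition idempotent_semiring (I : semiring) : Prop :=
  forall x : I, x + x = x /\ x * x = x.

Definition b_lattice (Y : semiring) : Prop :=
  (forall x : Y, x * x = x) /\
  (forall x : Y, x + x = x) /\ (forall x y : Y, x + y = y + x).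

Definition b_lattice_of_skew_rings (S : semiring) : Prop :=
  exists rho : congruence S,
    b_lattice (quotient rho) /\ forall x : S, subskew_ring (rho x).

Definition b_lattice_of_skew_rings_congruence (S : semiring)
    (xi : congruence S) : Prop :=
  b_lattice_of_skew_rings (quotient xi).

(** * The elements [0_x] and the relation [Y] *)

Definition is_zero_at (S : semiring) (x e : S) : Prop :=
  exists (n : positive) (G : S -> Prop),
    maximal_additive_subgroup G e /\ G (nfold n x).

(* Only meaningful when a zero at [x] exists, which is the case as soon as [S]
   is quasi completely regular; see [zero_atP], [is_zero_at_uniq] and
   [zero_at_decomposition] below. *)
Definition zero_at (S : semiring) (x : S) : S :=
  epsilon (inhabits x) (is_zero_at x).

Definition scrY (S : semiring) : relation S :=
  fun a b => forall x : S,
    additive_inverses (a + zero_at a) x <-> additive_inverses (b + zero_at b) x.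

Section ZeroAt.
Variable S : semiring.
Implicit Types (x y e f : S) (G H : S -> Prop).

Lemma nfold_succ n x : nfold (Pos.succ n) x = x + nfold n x.
Proof. apply Pos.iter_op_succ; apply addA. Qed.

Lemma nfold_mul n m x : nfold (m * n) x = nfold m (nfold n x).
Proof.
assert (nfold_add : forall p q, nfold (p + q) x = nfold p x + nfold q x).
{ intros p q; induction p as [|p IH] using Pos.peano_ind.
  - now rewrite Pos.add_1_l, nfold_succ.
  - now rewrite Pos.add_succ_l, !nfold_succ, IH, addA. }
induction m as [|m IH] using Pos.peano_ind; [reflexivity|].
now rewrite Pos.mul_succ_l, nfold_add, nfold_succ, IH.
Qed.

Lemma subgroup_nfold G e n x : additive_subgroup G e -> G x -> G (nfold n x).
Proof.
intros (_ & Hadd & _) Hx; induction n as [|n IH] using Pos.peano_ind.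
- exact Hx.
- rewrite nfold_succ; auto.
Qed.

Lemma subgroup_id_uniq G H e f x :
  additive_subgroup G e -> additive_subgroup H f -> G x -> H x -> e = f.
Proof.
intros (_ & _ & GI & GV) (_ & _ & HI & HV) Gx Hx.
destruct (GV x Gx) as (y & _ & Hy & _), (HV x Hx) as (z & _ & _ & Hz).
transitivity (f + e).
- now rewrite <- Hy, addA, (proj1 (HI x Hx)).
- now rewrite <- Hz, <- addA, (proj2 (GI x Gx)).
Qed.

Definition units_at e : S -> Prop := fun y =>
  (e + y = y /\ y + e = y) /\
  exists z, (e + z = z /\ z + e = z) /\ y + z = e /\ z + y = e.

Lemma units_at_maximal e : e + e = e -> maximal_additive_subgroup (units_at e) e.
Proof.
intros He; split; [split; [|split; [|split]]|].
- split; [auto|exists e; auto].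
- intros x y ((x1 & x2) & x' & (x3 & x4) & x5 & x6)
    ((y1 & y2) & y' & (y3 & y4) & y5 & y6).
  split; [now rewrite addA, x1, <- addA, y2|].
  exists (y' + x'); split; [now rewrite addA, y3, <- addA, x4|split].
  + now rewrite <- addA, (addA y), y5, x3.
  + now rewrite <- addA, (addA x'), x6, y1.
- now intros x [Hx _].
- intros x (Hx & x' & Hx' & H1 & H2); exists x'; split; [|auto].
  split; [auto|exists x; auto].
- intros H f HH Hsub.
  assert (Ue : units_at e e) by (split; [auto|exists e; auto]).
  assert (Hef : f = e).
  { destruct HH as (_ & _ & HI & HV).
    destruct (HV e (Hsub e Ue)) as (z & _ & Hz & _).
    now rewrite <- Hz, <- He, <- addA, Hz, (proj2 (HI e (Hsub e Ue))). }
  subst f; destruct HH as (_ & _ & HI & HV); intros x Hx.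
  split; [auto|].
  destruct (HV x Hx) as (z & Hz & H1 & H2); exists z; auto.
Qed.

Lemma subgroup_units G e x : additive_subgroup G e -> G x -> units_at e x.
Proof.
intros (_ & _ & GI & GV) Gx; split; [auto|].
destruct (GV x Gx) as (z & Hz & H1 & H2); exists z; auto.
Qed.

Lemma subgroup_idem G e : additive_subgroup G e -> e + e = e.
Proof. intros (Ge & _ & GI & _); exact (proj1 (GI e Ge)). Qed.

Lemma is_zero_at_uniq x e f : is_zero_at x e -> is_zero_at x f -> e = f.
Proof.
intros (n & G & [HG _] & Gx) (m & H & [HH _] & Hx).
apply (subgroup_id_uniq HG HH (x := nfold (m * n) x)).
- rewrite nfold_mul; exact (subgroup_nfold m HG Gx).
- rewrite Pos.mul_comm, nfold_mul; exact (subgroup_nfold n HH Hx).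
Qed.

Lemma zero_atP : quasi_completely_regular S -> forall x, is_zero_at x (zero_at x).
Proof.
intros QS x; unfold zero_at; apply epsilon_spec.
destruct (QS x) as (n & y & H1 & H2 & _).
set (a := nfold n x) in *.
assert (He1 : (a + y) + a = a) by auto.
assert (He2 : a + (a + y) = a) by now rewrite H2, addA, <- H1.
assert (He : (a + y) + (a + y) = a + y) by now rewrite addA, He1.
exists (a + y), n, (units_at (a + y)); split; [exact (units_at_maximal He)|].
split; [split; auto|].
assert (Hye : y + (a + y) = (a + y) + y) by now rewrite addA, <- H2.
exists ((a + y) + y); split; [split|split].
- now rewrite addA, He.
- now rewrite <- addA, Hye, addA, He.
- fold a; now rewrite addA, He2.
- fold a; now rewrite <- addA, <- H2, He.
Qed.

(* In a decomposition of [S] as an idempotent semiring of quasi skew-rings,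
   [0_x] is the only additive idempotent of the component of [x]. *)
Lemma zero_at_decomposition (eta : congruence S) :
  idempotent_semiring (quotient eta) ->
  (forall x, quasi_subskew_ring (eta x)) ->
  forall x e, is_zero_at x e <-> eta x e /\ e + e = e.
Proof.
intros HI HT x e.
destruct (HT x) as (_ & R & HRT & (_ & f & HR) & Hmul).
split.
- intros (n & G & [HG _] & Gx); split; [|exact (subgroup_idem HG)].
  destruct (Hmul x (cong_refl eta x)) as (m & Hm).
  assert (e = f) as ->; [|exact (HRT f (proj1 HR))].
  apply (subgroup_id_uniq HG HR (x := nfold (m * n) x)).
  + rewrite nfold_mul; exact (subgroup_nfold m HG Gx).
  + rewrite Pos.mul_comm, nfold_mul; exact (subgroup_nfold n HR Hm).
- intros [Hxe He].
  assert (Hn : forall n, nfold n e = e).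
  { intros n; induction n as [|n IH] using Pos.peano_ind; [reflexivity|].
    now rewrite nfold_succ, IH. }
  destruct (Hmul e Hxe) as (k & Re); rewrite Hn in Re.
  assert (Hef : e = f).
  { destruct HR as (_ & _ & RI & RV); destruct (RV e Re) as (z & _ & Hz & _).
    now rewrite <- Hz, <- He, <- addA, Hz, (proj2 (RI e Re)). }
  subst f; destruct (Hmul x (cong_refl eta x)) as (m & Hm).
  exists m, (units_at e); split; [exact (units_at_maximal He)|].
  exact (subgroup_units HR Hm).
Qed.
End ZeroAt.

(* Main.v *)
Require Import Defs.
From Stdlib Require Import PArith Relations.

Set Implicit Arguments.
Unset Strict Implicit.

Local Open Scope semiring_scope.

(** In a b-lattice of skew-rings the additive reduct is a semilattice of
    groups, so additive inverses are unique, and [x + 0_x = x] because [0_x] is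
    the identity of the group containing [x]. In [S] every [x + 0_x] has an
    additive inverse. Hence if [a Y b], a common inverse of [a + 0_a] and
    [b + 0_b] maps to a common inverse of the [nu]-classes of [a] and [b],
    which therefore coincide. *)

Lemma nfold_succ_r (S : semiring) n (x : S) :
  nfold (Pos.succ n) x = nfold n x + x.
Proof.
induction n as [|n IH] using Pos.peano_ind; [reflexivity|].
rewrite nfold_succ; rewrite IH at 1; now rewrite addA, <- nfold_succ.
Qed.

(** Once a multiple of [x] in the group of [e] is written as [m + x], its group inverse [z] makes
    [z + m] a left inverse of [x + e] relative to [e]. *)
Lemma add_zero_regular (S : semiring) (x e : S) :
  is_zero_at x e -> exists y, additive_inverses (x + e) y.
Proof.
intros (n & G & [HG _] & Gx).
(* Passing from [n] to [2n] keeps [2n - 1] positive, so one [x] splits off even when [n = 1]. *)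
assert (Gx2 : G (nfold (Pos.succ (Pos.pred_double n)) x)).
{ rewrite Pos.succ_pred_double.
  change (xO n) with (2 * n)%positive; rewrite nfold_mul.
  exact (subgroup_nfold 2 HG Gx). }
rewrite nfold_succ_r in Gx2; set (m := nfold _ x) in Gx2.
pose proof (subgroup_idem HG) as He.
destruct HG as (_ & _ & _ & GV); destruct (GV _ Gx2) as (z & _ & _ & Hz).
assert (Hy : (z + m) + (x + e) = e).
{ now rewrite addA, <- (addA z), Hz, He. }
(* The leading [e] secures the second inverse equation, where [z + m] alone would return
   [e + (z + m)]. *)
exists (e + (z + m)); split.
- now rewrite <- addA, <- (addA e), Hy, <- !addA, !He.
- now rewrite <- (addA e), Hy, He, (addA e e), He.
Qed.

(** Mutual inverses fall into one class over the semilattice, so [a], [b] and [x] share a group, in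
    which [a = b + x + a = b]. *)
Lemma inverse_of_unique (S : semiring) (a b x : S) :
  b_lattice_of_skew_rings S ->
  additive_inverses a x -> additive_inverses b x -> a = b.
Proof.
intros (rho & (_ & HI & HC) & HR) [Ha Hxa] [Hb Hxb].
(* In the quotient the two equations reduce to [c + x = c] and [c + x = x]. *)
assert (Hrho : forall c, c + x + c = c -> x + c + x = x -> rho x c).
{ intros c H1 H2; apply class_of_eq.
  apply (f_equal (class_of rho)) in H1, H2.
  rewrite <- !quotient_addE in H1, H2.
  rewrite HC, addA, HI in H1, H2.
  rewrite HC in H2; exact (eq_trans (eq_sym H2) H1). }
destruct (HR x) as (_ & e & _ & _ & GI & GV).
pose proof (Hrho a Ha Hxa) as Ga; pose proof (Hrho b Hb Hxb) as Gb.
destruct (GV a Ga) as (a' & _ & Ha' & Ha''), (GV b Gb) as (b' & _ & Hb' & Hb'').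
pose proof (GI x (cong_refl rho x)) as [Hex Hxe].
assert (Hxa1 : x + a = e).
{ now rewrite <- Hex, <- Ha'', <- (addA a'), <- addA, Ha. }
assert (Hbx1 : b + x = e).
{ now rewrite <- Hxe, <- Hb', (addA x), (addA b), (addA b), Hb. }
now rewrite <- (proj1 (GI a Ga)), <- Hbx1, <- addA, Hxa1, (proj2 (GI b Gb)).
Qed.

Section ClassOf.
Variables (S : semiring) (xi : congruence S).
Local Notation cl := (class_of xi : S -> quotient xi).

Lemma class_of_nfold n (x : S) : cl (nfold n x) = nfold n (cl x).
Proof.
induction n as [|n IH] using Pos.peano_ind; [reflexivity|].
now rewrite !nfold_succ, <- IH, quotient_addE.
Qed.

Lemma class_of_subgroup (G : S -> Prop) (e : S) :
  additive_subgroup G e ->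
  additive_subgroup (fun X : quotient xi => exists x, G x /\ X = cl x) (cl e).
Proof.
intros (Ge & Gadd & GI & GV); split; [|split; [|split]].
- now exists e.
- intros X Y (x & Gx & ->) (y & Gy & ->); exists (x + y).
  rewrite quotient_addE; auto.
- intros X (x & Gx & ->); rewrite !quotient_addE.
  now destruct (GI x Gx) as [-> ->].
- intros X (x & Gx & ->); destruct (GV x Gx) as (y & Gy & H1 & H2).
  exists (cl y); rewrite !quotient_addE, H1, H2; split; [now exists y | auto].
Qed.

(** The image of [G] and the skew-ring class of [cl x] both contain [nfold n (cl x)], so they share
    the identity [cl e], which fixes [cl x]. *)
Lemma class_of_add_zero (x e : S) :
  b_lattice_of_skew_rings_congruence xi -> is_zero_at x e ->
  cl (x + e) = cl x.
Proof.
intros (rho & _ & HR) (n & G & [HG _] & Gx).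
destruct (HR (cl x)) as (_ & f & Hf).
assert (Hef : cl e = f).
{ apply (subgroup_id_uniq (class_of_subgroup HG) Hf (x := nfold n (cl x))).
  - exists (nfold n x); split; [exact Gx | now rewrite class_of_nfold].
  - exact (subgroup_nfold n Hf (cong_refl rho (cl x))). }
destruct Hf as (_ & _ & GI & _).
rewrite <- quotient_addE, Hef; exact (proj2 (GI _ (cong_refl rho (cl x)))).
Qed.

Lemma class_of_additive_inverses (x y : S) :
  additive_inverses x y -> additive_inverses (cl x) (cl y).
Proof. now intros [H1 H2]; split; rewrite !quotient_addE, ?H1, ?H2. Qed.

Lemma scrY_sub_b_lattice_congruence :
  quasi_completely_regular S -> b_lattice_of_skew_rings_congruence xi ->
  inclusion S (@scrY S) xi.
Proof.
intros hS Hxi a b Hab.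
pose proof (zero_atP hS a) as Za; pose proof (zero_atP hS b) as Zb.
destruct (add_zero_regular Za) as (y & Ha).
pose proof (proj1 (Hab y) Ha) as Hb.
apply class_of_additive_inverses in Ha, Hb.
rewrite class_of_add_zero in Ha, Hb by assumption.
apply class_of_eq; exact (inverse_of_unique Hxi Ha Hb).
Qed.
End ClassOf.

Theorem theorem5p10 (S : semiring) (nu : congruence S)
  (hS : quasi_completely_regular S)
  (hnu : is_least_congruence (@b_lattice_of_skew_rings_congruence S) nu) :
  congruence_interval (eq_congruence S) nu (generated_congruence (@scrY S)).
Proof.
split.
- intros x y ->; apply cong_refl.
(* [Hxy] relates [x] and [y] in every congruence containing [scrY]; it is used for [nu]. *)
- intros x y Hxy; apply Hxy.
  exact (scrY_sub_b_lattice_congruence hS (proj1 hnu)).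
Qed.
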